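(* Let $\mu>0$ and let $\rho_\mu(t_1,\dots,t_n)=\langle\Delta x(t_1)\Delta x(t_2)\cdots\Delta x(t_n)\rangle$ be the $n$-point position auto-correlation function of the Fly-and-Die dynamics with parameters $l,\mu$, where $t_1<t_2<\cdots<t_n$. Then $$\rho_\mu(t_1,\dots,t_n)=l\sum_{j=0}^{n}\prod_{k=1}^{n-j}t_k\left(\frac{\mu}{\mu-j}\left(t_{n-j}^{\,j-\mu}-t_{n-j+1}^{\,j-\mu}\right)\right),$$ where $t_{n+1}=\infty$ (so $t_{n+1}^{-\mu}=0$), $t_0=l^{1/\mu}$, and the empty product equals $1$.
   Context: Fly-and-Die dynamics with parameters $l>0$, $\mu>0$: let $t_c(x_0)=(l/x_0)^{1/\mu}$. The trajectory starting at $x_0$ is $x(x_0,t)=x_0+t$ for $t\le t_c(x_0)$ and $x(x_0,t)=x_0+t_c(x_0)$ for $t\ge t_c(x_0)$. The displacement is $\Delta x(t)=x(x_0,t)-x_0$. The initial condition $x_0$ is uniformly distributed in $[0,1]$ and $\langle f\rangle=\int_0^1 f\,dx_0$. The probability of a flight longer than $t$, i.e. the fraction of initial conditions with $t_c(x_0)>t$, is taken to be $P(>t)=l/t^{\mu}$.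
   Formalization: The times are assumed to satisfy t_0 = l^{1/μ} ≤ t_1, without which the formula fails (n=1, l=1, μ=2, t_1=1/2); for μ in {1,…,n}, where the term j=μ is 0/0, the formula is read as its limit as the parameter tends to μ. *)

(* Defs.v *)
From HB Require Import structures.
From mathcomp Require Import all_boot all_order all_algebra.
From mathcomp Require Import all_classical all_reals all_analysis.

Set Implicit Arguments.
Unset Strict Implicit.
Unset Printing Implicit Defensive.

Import Order.TTheory GRing.Theory Num.Theory.
Import numFieldNormedType.Exports.

Local Open Scope classical_set_scope.
Local Open Scope ring_scope.

Section FlyAndDie.
Context {R : realType}.
Implicit Types (l mu : R) (n k : nat) (t : nat -> R).

(* At x0 = 0 (infinite flight time in the model) this evaluates to 0; a single
   initial condition does not affect averages over [0, 1]. *)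
Definition flight_time l mu (x0 : R) : R := (l / x0) `^ mu^-1.

Definition trajectory l mu (x0 s : R) : R :=
  if s <= flight_time l mu x0 then x0 + s else x0 + flight_time l mu x0.

Definition displacement l mu (x0 s : R) : R := trajectory l mu x0 s - x0.

(* Average over initial conditions uniformly distributed in [0, 1]. *)
Definition average (f : R -> R) : R :=
  (\int[lebesgue_measure]_(x0 in `[0%R, 1%R]) f x0)%R.

(* The probability P(>s) of a flight longer than s. *)
Definition flight_prob l mu (s : R) : \bar R :=
  lebesgue_measure [set x0 : R | 0 <= x0 <= 1 /\ s < flight_time l mu x0].

(* The times are t 1, ..., t n; the other values of t are irrelevant. *)
Definition autocorrelation l mu n t : R :=
  average (fun x0 => \prod_(1 <= k < n.+1) displacement l mu x0 (t k)).

(* The times t_0 = l^(1/mu), t_1, ..., t_n, t_(n+1) = oo. *)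
Definition ext_time l mu n t k : \bar R :=
  if k == 0%N then (l `^ mu^-1)%:E
  else if (k <= n)%N then (t k)%:E else +oo%E.

(* The power oo^a is 0, as for a < 0. It is only needed for a = - mu: in
   autocorrelation_formula the time t_(n+1) occurs only in the term j = 0.
   (The power poweR of the library sends +oo to +oo when a < 0.) *)
Definition time_pow (s : \bar R) (a : R) : R :=
  if s is r%:E then r `^ a else 0.

(* At mu = j with 1 <= j <= n the term of index j is 0 / 0, so that the right
   value is then the limit from nearby values of mu. *)
Definition autocorrelation_formula l mu n t : R :=
  l * \sum_(0 <= j < n.+1)
        ((\prod_(1 <= k < (n - j).+1) t k) *
         (mu / (mu - j%:R) *
          (time_pow (ext_time l mu n t (n - j)) (j%:R - mu) -
           time_pow (ext_time l mu n t (n - j).+1) (j%:R - mu)))).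

(* The law P(>s) = l / s^mu holds exactly for times s >= t_0 = l^(1/mu). *)
Lemma flight_probE l mu (s : R) : 0 < l -> 0 < mu -> 0 < s ->
  flight_prob l mu s = (l / s `^ mu)%:E <-> l `^ mu^-1 <= s.
Proof.
move=> l0 mu0 s0.
have smu0 : 0 < s `^ mu by exact: powR_gt0.
have c0 : 0 < l / s `^ mu by rewrite divr_gt0.
have muN : mu != 0 by rewrite gt_eqF.
have powK (x : R) : 0 <= x -> (x `^ mu^-1) `^ mu = x.
  by move=> x_ge0; rewrite -powRrM mulVf// powRr1.
have lep (x : R) : 0 <= x -> (x `^ mu^-1 <= s) = (x <= s `^ mu).
  move=> x_ge0; apply/idP/idP => H.
    rewrite -[leLHS]powK//; apply: ge0_ler_powR H; rewrite ?nnegrE ?powR_ge0//.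
      exact: ltW.
    exact: ltW.
  have -> : s = (s `^ mu) `^ mu^-1 by rewrite -powRrM mulfV// powRr1// ltW.
  by apply: ge0_ler_powR H; rewrite ?nnegrE ?powR_ge0// ltW// invr_gt0.
have ltp x : (0 <= x <= 1 /\ s < flight_time l mu x) <->
    (0 < x <= 1 /\ x < l / s `^ mu).
  have [->|x0] := eqVneq x 0.
    rewrite /flight_time invr0 mulr0 powR0 ?invr_eq0// ltxx.
    by split=> -[]// _; rewrite ltNge (ltW s0).
  have lt_time : 0 < x -> (s < flight_time l mu x) = (x < l / s `^ mu).
    move=> xgt0; have lx_ge0 : 0 <= l / x by rewrite ltW// divr_gt0.
    rewrite ltNge /flight_time lep// -ltNge.
    by rewrite ltr_pdivlMr// mulrC -ltr_pdivlMr.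
  split=> -[/andP[]].
    move=> xge0 x1; have xgt0 : 0 < x by rewrite lt0r x0.
    by rewrite lt_time// xgt0 x1.
  by move=> xgt0 x1; rewrite lt_time// x1 (ltW xgt0).
rewrite lep ?(ltW l0)//; have [ls|ls] := leP l (s `^ mu).
  split=> // _.
  rewrite /flight_prob (_ : [set _ | _] = `]0, (l / s `^ mu)[%classic); last first.
    apply/seteqP; split=> x /=; rewrite in_itv/=.
      by move=> /ltp[/andP[-> _] ->].
    move=> /andP[xgt0 xc]; apply/ltp; split=> //; rewrite xgt0/=.
    by rewrite (le_trans (ltW xc))// ler_pdivrMr// mul1r.
  by rewrite lebesgue_measure_itv/= lte_fin c0 -EFinB subr0.
split=> //; rewrite /flight_prob (_ : [set _ | _] = `]0, 1]%classic); last first.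
  apply/seteqP; split=> x /=; rewrite in_itv/=.
    by move=> /ltp[->].
  move=> /andP[xgt0 x1]; apply/ltp; rewrite xgt0 x1; split=> //.
  by rewrite (le_lt_trans x1)// ltr_pdivlMr// mul1r.
rewrite lebesgue_measure_itv/= lte_fin ltr01 -EFinB subr0 => -[] E.
have : 1 < l / s `^ mu by rewrite ltr_pdivlMr// mul1r.
by rewrite -E ltxx.
Qed.

End FlyAndDie.

(* Main.v *)
(** The displacement at time [s] is the minimum of [s] and the flight time
    [T x0], which decreases in [x0] and equals [t_m] at [x0 = l / t_m^mu].
    Cutting [0, 1] at these points, the integrand on the m-th piece is
    [t_1 ... t_m T^(n - m)]. A primitive of [T^j] is, up to the factor [- l mu],
    a primitive of [u^(j - mu - 1)] evaluated at [T]. If the latter is chosen to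
    vanish at 1 it depends continuously on the exponent, through the logarithm
    at [mu = j], so that the resonant values of [mu] need no separate
    integral. *)

Require Import Defs.
From mathcomp Require Import all_boot all_order all_algebra.
From mathcomp Require Import all_classical all_reals all_analysis.
From mathcomp Require Import ring lra.

Set Implicit Arguments.
Unset Strict Implicit.
Unset Printing Implicit Defensive.

Import Order.TTheory GRing.Theory Num.Theory.
Import numFieldNormedType.Exports.

Local Open Scope classical_set_scope.
Local Open Scope ring_scope.

(** * Primitives of powers, continuous in the exponent *)

Section BoxCox.
Context {R : realType}.
Implicit Types (c x y u : R).

(* The primitive of x^(c - 1) vanishing at 1: this normalisation, unlike
   x^c / c, makes it continuous in c, also at c = 0. *)
Definition boxcox c x : R := if c == 0 then ln x else (x `^ c - 1) / c.

Lemma is_derive_boxcox c x : 0 < x -> is_derive x 1 (boxcox c) (x `^ (c - 1)).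
Proof.
move=> x0; rewrite /boxcox; have [->|c0] := eqVneq c 0.
  rewrite sub0r powR_inv1 ?ltW//; exact: is_derive1_ln.
have -> : (fun y : R => (y `^ c - 1) / c) = (fun y => c^-1 *: (y `^ c - 1)).
  by apply/funext => y; rewrite mulrC.
have D := is_derive1_powR c x0.
apply: is_derive_eq.
by rewrite subr0 scalerA mulVf// scale1r.
Qed.

Lemma boxcoxB c x y : c != 0 -> boxcox c x - boxcox c y = (x `^ c - y `^ c) / c.
Proof. by move=> /negPf c0; rewrite /boxcox c0 -mulrBl opprB addrA subrK. Qed.

(** The singularity of (e^y - 1) / y at 0 is removable; the value 1 fills it in. *)
Definition expR_quot y : R := if y == 0 then 1 else (expR y - 1) / y.

Lemma continuous_expR_quot : continuous expR_quot.
Proof.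
move=> y; have [->|y0] := eqVneq y 0.
  apply/continuous_withinNx.
  rewrite {2}/expR_quot eqxx.
  have H : (expR u - 1) / u @[u --> (0:R)^'] --> (1:R).
    apply: (@lhopital R (fun u => expR u - 1) expR id (fun=> 1) (-1) 1).
    - by rewrite in_itv /= ltrN10 ltr01.
    - by move=> u _; apply: is_derive_eq; rewrite subr0.
    - suff : expR x - 1 @[x --> (0 : R)] --> expR 0 - 1 by rewrite expR0 subrr.
      by apply: cvgB; [exact: continuous_expR|exact: cvg_cst].
    - exact: cvg_id.
    - by move=> *; rewrite oner_eq0.
    - under eq_fun do rewrite divr1.
      by rewrite -expR0; exact: continuous_expR.
  apply: cvg_trans H; apply: near_eq_cvg; near=> u.
  rewrite /expR_quot ifF//; apply/negbTE.
  near: u; exact: nbhs_dnbhs_neq.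
have H : (expR u - 1) / u @[u --> y] --> (expR y - 1) / y.
  apply: cvgM; last exact: cvgV.
  by apply: cvgB; [exact: continuous_expR|exact: cvg_cst].
rewrite /continuous_at {2}/expR_quot (negPf y0).
apply: cvg_trans H; apply: near_eq_cvg; near=> u.
rewrite /expR_quot ifF//; apply/negbTE.
near: u; have : open_nbhs y [set u | u != 0] by split => //; exact: open_neq.
exact: open_nbhs_nbhs.
Unshelve. all: by end_near. Qed.

(** Writing x^c as e^(c ln x) moves the case distinction at [c = 0] into [expR_quot], so that
    continuity in [c] and in [x] together reduces to that of [ln] and [expR_quot]. *)
Lemma boxcoxE c x : 0 < x -> boxcox c x = ln x * expR_quot (c * ln x).
Proof.
move=> x0; rewrite /boxcox /expR_quot mulf_eq0; have [->|c0] /= := eqVneq c 0.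
  by rewrite mulr1.
(* The argument [c * ln x] also vanishes when [ln x = 0]; both sides are then 0. *)
have [x1|x1] := eqVneq (ln x) 0.
  by rewrite x1 mul0r /powR gt_eqF// x1 mulr0 expR0 subrr mul0r.
by rewrite /powR gt_eqF//; field; rewrite c0 x1.
Qed.

End BoxCox.

Lemma powRB_gt0 {R : realType} (x r s : R) : 0 < x ->
  x `^ (r - s) = x `^ r / x `^ s.
Proof. by move=> x0; rewrite powRB// (gt_eqF x0) implybT. Qed.

Lemma is_derive1_continuous {R : realType} (f : R -> R) (x d : R) :
  is_derive x 1 f d -> {for x, continuous f}.
Proof.
move=> D; have df : derivable f x 1 := @ex_derive _ _ _ _ _ _ _ D.
exact/differentiable_continuous/derivable1_diffP/df.
Qed.

(** * The flight time: levels, derivative, integrals of its powers *)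

Section FlightTime.
Context {R : realType} (l mu : R) (l_gt0 : 0 < l) (mu_gt0 : 0 < mu).
Implicit Types (a b s x y : R) (j : nat).
Local Notation T := (flight_time l mu).

Let mu_neq0 : mu != 0.
Proof. by rewrite gt_eqF. Qed.

Lemma flight_time_gt0 x : 0 < x -> 0 < T x.
Proof. by move=> x0; rewrite powR_gt0// divr_gt0. Qed.

Lemma flight_timeX x : 0 < x -> T x `^ mu = l / x.
Proof. by move=> x0; rewrite -powRrM mulVf// powRr1// ltW// divr_gt0. Qed.

Lemma flight_time_level s : 0 < s -> T (l / s `^ mu) = s.
Proof.
move=> s0; rewrite /flight_time invf_div mulrC divfK ?gt_eqF//.
by rewrite -powRrM mulfV// powRr1// ltW.
Qed.

Lemma flight_time_anti x y : 0 < x -> x <= y -> T y <= T x.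
Proof.
move=> x0 xy; have y0 := lt_le_trans x0 xy.
apply: ge0_ler_powR; rewrite ?nnegrE;
  try by rewrite ltW// ?invr_gt0// divr_gt0.
by rewrite ler_pM2l// lef_pV2.
Qed.

Lemma is_derive_flight_time x : 0 < x ->
  is_derive x 1 T (- (T x / (mu * x))).
Proof.
move=> x0.
have lx0 : 0 < l / x by rewrite divr_gt0.
have D1 := is_derive1_powR mu^-1 lx0.
have D2 : is_derive x 1 (fun y : R => l * y^-1) (l * (- x ^- 2)).
  have xn : id x != 0 by rewrite gt_eqF.
  have D := is_deriveV xn (is_derive_id x 1).
  by apply: is_derive_eq; rewrite /GRing.scale /= mulr1.
have D : is_derive x 1 T _ := @is_derive1_comp R
  (fun y => y `^ mu^-1) (fun y => l * y^-1) x _ _ D1 D2.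
apply: is_derive_eq.
rewrite powRB_gt0// powRr1 ?(ltW lx0)// /flight_time.
by field; rewrite mu_neq0 !gt_eqF.
Qed.

(** By the chain rule the derivative is l T^(j - mu) / x, and T^mu = l / x turns this into T^j. *)
Lemma is_derive_primitive j x : 0 < x ->
  is_derive x 1 (fun y => - (l * mu * boxcox (j%:R - mu) (T y))) (T x ^+ j).
Proof.
move=> x0; have T0 := flight_time_gt0 x0.
have D := is_derive1_comp (is_derive_boxcox (j%:R - mu) T0)
  (is_derive_flight_time x0).
have -> : (fun y => - (l * mu * boxcox (j%:R - mu) (T y))) =
    (fun y => (- (l * mu)) *: (boxcox (j%:R - mu) \o T) y).
  by apply/funext => y; rewrite /GRing.scale /= mulNr.
apply: is_derive_eq; rewrite /GRing.scale /=.
rewrite !powRB_gt0// powRr1 ?ltW// powR_mulrn ?ltW//.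
rewrite flight_timeX//.
by field; rewrite mu_neq0 !gt_eqF.
Qed.

Lemma continuous_flight_time_exp j x : 0 < x ->
  {for x, continuous (fun y => T y ^+ j)}.
Proof.
move=> x0; have D := is_derive_flight_time x0.
have : {for x, continuous T}.
  exact: is_derive1_continuous D.
move=> cT; apply: (@continuous_comp _ _ _ T (fun y => y ^+ j)) => //.
exact: exprn_continuous.
Qed.

Lemma Rintegral_flight_time_exp j a b : 0 < a -> a <= b ->
  (\int[lebesgue_measure]_(x in `]a, b]) T x ^+ j)%R =
  l * mu * (boxcox (j%:R - mu) (T a) - boxcox (j%:R - mu) (T b)).
Proof.
(* The case [a = b] does occur: the first two thresholds coincide when t_1 = t_0. *)
move=> a0; rewrite le_eqVlt => /predU1P[<-|ab].
  by rewrite subrr mulr0 set_itv_ge ?Rintegral_set0// bnd_simp ltxx.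
pose G y := - (l * mu * boxcox (j%:R - mu) (T y)).
have gt0 x : x \in `[a, b] -> 0 < x.
  by rewrite in_itv /= => /andP[/(lt_le_trans a0)].
have cT : {within `[a, b], continuous (fun y => T y ^+ j)}.
  apply: continuous_in_subspaceT => x; rewrite inE/= => /gt0.
  exact: continuous_flight_time_exp.
rewrite Rintegral_itv_obnd_cbnd; last first.
  have := continuous_compact_integrable (@segment_compact _ a b) cT.
  by apply: integrableS => //; exact: subset_itv_oc_cc.
have cG x : 0 < x -> G y @[y --> x] --> G x.
  move=> x0; have D := is_derive_primitive j x0.
  exact: is_derive1_continuous D.
have b0 := lt_trans a0 ab.
rewrite /Rintegral (@continuous_FTC2 _ _ G a b)//.
- by rewrite -EFinB [LHS]/= /G opprK mulrBr addrC.
- split.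
  + move=> x xab; have := gt0 x (subset_itv_oo_cc xab) => x0.
    by have D := is_derive_primitive j x0.
  + by apply: cvg_at_right_filter; exact: cG.
  + by apply: cvg_at_left_filter; exact: cG.
- move=> x xab; have := gt0 x (subset_itv_oo_cc xab) => x0.
  have D := is_derive_primitive j x0.
  by rewrite derive1E derive_val.
Qed.

End FlightTime.

(** * The closed formula as a continuous function of mu *)

Section Autocorrelation.
Context {R : realType} (l : R) (n : nat) (t : nat -> R).
Context (l_gt0 : 0 < l).

(** The finite values of [ext_time], as reals. Only node 0 moves with [mu]. *)
Definition node (mu : R) (k : nat) : R := if k == 0%N then l `^ mu^-1 else t k.

(* The term j = 0 is written apart, because t_(n+1) = oo there; the others use
   boxcox in order to make sense at mu = j. *)
Definition log_formula (mu : R) : R :=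
  l * (\prod_(1 <= k < n.+1) t k * t n `^ (- mu) +
       \sum_(1 <= j < n.+1) \prod_(1 <= k < (n - j).+1) t k *
         (mu * (boxcox (j%:R - mu) (node mu (n - j).+1%N) -
                boxcox (j%:R - mu) (node mu (n - j)%N)))).

(** Off resonance a difference of two [boxcox] values is a difference of powers over j - mu; the
    sign relative to mu - j exchanges the two nodes. For j = 0 the quotient mu / mu is 1 and t_(n+1)
    contributes 0. *)
Lemma autocorrelation_formulaE (mu : R) : (0 < n)%N -> mu != 0 ->
  (forall j, (1 <= j <= n)%N -> mu != j%:R) ->
  autocorrelation_formula l mu n t = log_formula mu.
Proof.
move=> n0 mu0 muj; rewrite /autocorrelation_formula /log_formula.
rewrite [X in l * X = _]big_ltn// subn0 subr0 divff// mul1r sub0r.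
rewrite /ext_time /= eqn0Ngt n0 /= leqnn ltnn /= subr0.
congr (_ * (_ + _)); apply: eq_big_nat => j /andP[j1]; rewrite ltnS => jn.
have cj : j%:R - mu != 0 by rewrite subr_eq0 eq_sym muj// j1.
(* For j >= 1 the later time t_(n-j+1) has index at most n, so it is finite. *)
have nj : (n - j < n)%N by rewrite -subSn// leq_subLR -{1}(add1n n) leq_add2r.
congr (_ * _); rewrite boxcoxB// nj leq_subr /node /=.
have -> : (if (n - j)%N == 0%N then (l `^ mu^-1)%:E else (t (n - j)%N)%:E) =
    (if (n - j)%N == 0%N then l `^ mu^-1 else t (n - j)%N)%:E by case: ifP.
by rewrite /=; field; rewrite cj -opprB oppr_eq0.
Qed.

Context (t_gt0 : forall k, (1 <= k <= n)%N -> 0 < t k).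

(** Through [boxcoxE] each term depends on [nu] by way of [expR_quot] and the logarithms of the
    nodes, and that of node 0 is ln l / nu. Nothing singular happens at [nu = j]. *)
Lemma cvg_log_formula (mu : R) : (0 < n)%N -> mu != 0 ->
  log_formula nu @[nu --> mu] --> log_formula mu.
Proof.
move=> n0 mu0.
have cV : nu^-1 @[nu --> mu] --> mu^-1 by apply: cvgV.
have node_gt0 nu k : (k <= n)%N -> 0 < node nu k.
  by case: k => [|k] kn; rewrite /node/= ?powR_gt0// t_gt0.
have cnode k : ln (node nu k) @[nu --> mu] --> ln (node mu k).
  rewrite /node; case: k => [|k] /=; last exact: cvg_cst.
  rewrite ln_powR; under eq_fun do rewrite ln_powR.
  by apply: cvgM => //; exact: cvg_cst.
have cbc j k : (k <= n)%N -> boxcox (j%:R - nu) (node nu k) @[nu --> mu] -->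
    boxcox (j%:R - mu) (node mu k).
  move=> kn; rewrite boxcoxE ?node_gt0//.
  under eq_fun do rewrite boxcoxE ?node_gt0//.
  apply: cvgM; first exact: cnode.
  apply: (@cvg_comp _ _ _ (fun nu => (j%:R - nu) * ln (node nu k)) expR_quot).
    apply: cvgM; last exact: cnode.
    by apply: cvgB; [exact: cvg_cst|exact: cvg_id].
  exact: continuous_expR_quot.
apply: cvgM; first exact: cvg_cst.
apply: cvgD.
  apply: cvgM; first exact: cvg_cst.
  rewrite /powR gt_eqF ?t_gt0 ?n0 ?leqnn//.
  apply: (@cvg_comp _ _ _ (fun nu => - nu * ln (t n)) expR).
    by apply: cvgM; [apply: cvgN; exact: cvg_id|exact: cvg_cst].
  exact: continuous_expR.
(* This keeps the bounds on j available for each summand. *)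
rewrite [X in _ --> X]big_nat_cond; under eq_fun do rewrite big_nat_cond.
apply: cvg_big => [|j]; first exact: add_continuous.
move=> /andP[/andP[j1 jn] _].
have nj : (n - j < n)%N by rewrite -subSn// leq_subLR -{1}(add1n n) leq_add2r.
apply: cvgM; first exact: cvg_cst.
apply: cvgM; first exact: cvg_id.
by apply: cvgB; apply: cbc => //; exact: leq_subr.
Qed.

End Autocorrelation.

(** * Integration piece by piece between the thresholds *)

Section Integral.
Context {R : realType} (l mu : R) (n : nat) (t : nat -> R).
Context (l_gt0 : 0 < l) (mu_gt0 : 0 < mu) (n_gt0 : (0 < n)%N).
Context (t_incr :
  forall i k : nat, (1 <= i)%N -> (i < k)%N -> (k <= n)%N -> t i < t k).
Context (t0_le_t1 : l `^ mu^-1 <= t 1%N).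
Local Notation T := (flight_time l mu).
Local Notation s := (node l t mu).
Local Notation corr :=
  (fun x => \prod_(1 <= k < n.+1) displacement l mu x (t k)).

Lemma node_le i k : (i <= k)%N -> (k <= n)%N -> s i <= s k.
Proof.
rewrite leq_eqVlt => /predU1P[->//|]; rewrite /node.
case: k => // k; case: i => [_|i ik] kn /=; last exact/ltW/t_incr.
case: k kn => // k kn; apply: le_trans t0_le_t1 _.
exact/ltW/t_incr.
Qed.

Lemma node_gt0 k : (k <= n)%N -> 0 < s k.
Proof.
move=> kn; apply: lt_le_trans (node_le (leq0n k) kn).
by rewrite /node eqxx powR_gt0.
Qed.

Lemma displacementE x y : displacement l mu x y = Num.min y (T x).
Proof.
by rewrite /displacement /trajectory; case: leP => _; rewrite addrC addKr.
Qed.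

(** Each factor is the minimum of t_k and [T x], and the nodes increase: the first m factors are
    t_k, the others [T x]. For [m = n] no later time bounds [T x] from above. *)
Lemma corrE m x : (m <= n)%N -> s m <= T x ->
  ((m < n)%N -> T x <= s m.+1) ->
  corr x = \prod_(1 <= k < m.+1) t k * T x ^+ (n - m).
Proof.
move=> mn smT Tsm; rewrite [LHS](@big_cat_nat _ _ _ m.+1)//=; congr (_ * _).
  apply: eq_big_nat => -[//|k] /andP[_ km]; rewrite displacementE.
  by apply: min_l; apply: le_trans smT; apply: (@node_le k.+1 m).
rewrite -[in RHS]subSS -prodr_const_nat; apply: eq_big_nat => k /andP[mk kn].
rewrite displacementE; apply: min_r.
apply: le_trans (Tsm (leq_trans mk kn)) _.
by case: k mk kn => // k mk kn; apply: (@node_le m.+1 k.+1).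
Qed.

Definition threshold m := l / s m `^ mu.

Lemma threshold_gt0 m : (m <= n)%N -> 0 < threshold m.
Proof. by move=> mn; rewrite divr_gt0// powR_gt0// node_gt0. Qed.

Lemma threshold_le m : (m < n)%N -> threshold m.+1 <= threshold m.
Proof.
move=> mn; have [s0 s1] := (node_gt0 (ltnW mn), node_gt0 mn).
rewrite ler_pM2l// lef_pV2 ?posrE ?powR_gt0//.
by apply: ge0_ler_powR; rewrite ?nnegrE ?node_le//; exact: ltW.
Qed.

(** The choice t_0 = l^(1/mu) is the flight time from x0 = 1, so the last piece ends at the right
    end of [0, 1]. *)
Lemma threshold0 : threshold 0 = 1.
Proof.
rewrite /threshold /node eqxx /= -powRrM mulVf ?gt_eqF//.
by rewrite powRr1 ?ltW// divff ?gt_eqF.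
Qed.

Lemma flight_time_threshold m : (m <= n)%N -> T (threshold m) = s m.
Proof. by move=> mn; apply: flight_time_level => //; exact: node_gt0. Qed.

Lemma corr_integrable : lebesgue_measure.-integrable `[0, 1] (EFin \o corr).
Proof.
have t_ge0 k : (1 <= k < n.+1)%N -> 0 <= t k.
  by case: k => // k kn; exact/ltW/(@node_gt0 k.+1).
apply: measurable_bounded_integrable => //.
- by rewrite /= lebesgue_measure_itv/= lte_fin ltr01 -EFinB ltry.
(* Splitting the power of l / x exhibits measurable factors; the two forms agree at 0 too, where
   both powers are 0. *)
- apply: (@eq_measurable_fun _ _ _ _ _ (fun x => \prod_(1 <= k < n.+1)
    (cst (t k) \min (fun x => l `^ mu^-1 * x `^ (- mu^-1))) x)).
    move=> x; rewrite inE /= in_itv /= => /andP[x0 _].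
    apply: eq_bigr => k _; rewrite displacementE /flight_time /=.
    by rewrite powRM ?invr_ge0 ?(ltW l_gt0)// -(powR_inv1 x0) -powRrM mulN1r.
  apply: measurable_prod => k _.
  apply: measurable_realfun.measurable_minr => //.
  apply: measurable_realfun.measurable_funM => //.
  apply: measurable_funTS; exact: measurable_realfun.measurable_powR.
(* Although [T] is unbounded near 0, each factor lies between 0 and t_k. *)
- exists (\prod_(1 <= k < n.+1) t k); split; first exact: num_real.
  move=> M ltM x _; apply: le_trans (ltW ltM) => /=.
  rewrite normr_prod; rewrite big_nat_cond [leRHS]big_nat_cond.
  apply: ler_prod => k /andP[/t_ge0 tk _]; rewrite displacementE normr_ge0/=.
  by rewrite ger0_norm ?ge_min ?lexx// le_min tk powR_ge0.
Qed.

Lemma threshold_le1 m : (m <= n)%N -> threshold m <= 1.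
Proof.
elim: m => [|m IH] mn; first by rewrite threshold0.
by apply: le_trans (threshold_le mn) (IH (ltnW mn)).
Qed.

Lemma corr_integrableS b (i : interval R) : [set` i] `<=` `[0, b] -> b <= 1 ->
  lebesgue_measure.-integrable [set` i] (EFin \o corr).
Proof.
move=> ib b1; apply: integrableS corr_integrable => //.
apply: subset_trans ib _ => x /=; rewrite !in_itv/= => /andP[-> /le_trans].
by apply.
Qed.

Lemma Rintegral_corr_first :
  (\int[lebesgue_measure]_(x in `[0, threshold n]) corr x)%R =
  l * (\prod_(1 <= k < n.+1) t k * t n `^ (- mu)).
Proof.
have a0 := threshold_gt0 (leqnn n); have a1 := threshold_le1 (leqnn n).
(* The point 0 is removed because [T] evaluates to 0 there, and the integrand is not the product of
   the t_k. *)
rewrite -Rintegral_itv_obnd_cbnd; last first.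
  by apply: corr_integrableS a1; exact: subset_itv_oc_cc.
rewrite (@eq_Rintegral _ _ _ _ _ (fun=> \prod_(1 <= k < n.+1) t k)); last first.
  move=> x; rewrite inE /= in_itv/= => /andP[x0 xa].
  rewrite (@corrE n) ?ltnn// ?subnn ?expr0 ?mulr1//.
  by rewrite -flight_time_threshold//; exact: flight_time_anti.
rewrite Rintegral_cst//= lebesgue_measure_itv/= lte_fin a0 -EFinB subr0/=.
by rewrite /threshold /node eqn0Ngt n_gt0 /= powRN mulrCA.
Qed.

Lemma Rintegral_corr_step m : (m < n)%N ->
  (\int[lebesgue_measure]_(x in `[0, threshold m]) corr x)%R =
  (\int[lebesgue_measure]_(x in `[0, threshold m.+1]) corr x)%R +
  l * (\prod_(1 <= k < m.+1) t k *
    (mu * (boxcox ((n - m)%:R - mu) (s m.+1) -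
           boxcox ((n - m)%:R - mu) (s m)))).
Proof.
move=> mn; have [am am1] := (threshold_gt0 (ltnW mn), threshold_gt0 mn).
have aa := threshold_le mn; have a1 := threshold_le1 (ltnW mn).
apply/eqP; rewrite addrC -subr_eq; apply/eqP.
rewrite Rintegral_itvB ?bnd_simp ?(ltW am1)//; last first.
  exact: corr_integrableS (@subset_refl _ _) a1.
transitivity (\int[lebesgue_measure]_(x in `]threshold m.+1, threshold m])
    (\prod_(1 <= k < m.+1) t k * T x ^+ (n - m)))%R.
  apply: eq_Rintegral => x; rewrite inE /= in_itv/= => /andP[ax xa].
  have x0 := lt_trans am1 ax.
  apply: corrE => [|| _]; first exact: ltnW.
    by rewrite -flight_time_threshold 1?ltnW//; exact: flight_time_anti.
  by rewrite -flight_time_threshold//; apply: flight_time_anti => //; exact: ltW.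
rewrite RintegralZl//; last first.
  have cT : {within `[threshold m.+1, threshold m],
      continuous (fun y => T y ^+ (n - m))}.
    apply: continuous_in_subspaceT => x; rewrite inE/= in_itv/= => /andP[ax _].
    exact/continuous_flight_time_exp/(lt_le_trans am1).
  have := continuous_compact_integrable (@segment_compact _ _ _) cT.
  by apply: integrableS => //; exact: subset_itv_oc_cc.
rewrite Rintegral_flight_time_exp// !flight_time_threshold//; last exact: ltnW.
by rewrite -!mulrA mulrCA.
Qed.

Lemma autocorrelationE : autocorrelation l mu n t = log_formula l n t mu.
Proof.
rewrite /autocorrelation /average.
(* Pieces are added from left to right, longest flights first: after i steps the terms 0 to i of the
   formula are collected, and i = n reaches all of [0, 1]. *)
suff H i : (i <= n)%N ->
    (\int[lebesgue_measure]_(x in `[0, threshold (n - i)]) corr x)%R =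
    l * (\prod_(1 <= k < n.+1) t k * t n `^ (- mu) +
         \sum_(1 <= j < i.+1) \prod_(1 <= k < (n - j).+1) t k *
           (mu * (boxcox (j%:R - mu) (s (n - j).+1%N) -
                  boxcox (j%:R - mu) (s (n - j)%N)))).
  by have := H n (leqnn n); rewrite subnn threshold0.
elim: i => [_|i IH ni]; first by rewrite big_nil addr0 subn0 Rintegral_corr_first.
have nin : (n - i.+1 < n)%N by rewrite -subSn// leq_subLR -{1}(add1n n) leq_add2r.
rewrite Rintegral_corr_step// subnSK// IH ?(ltnW ni)//.
rewrite [X in _ = _ * (_ + X)]big_nat_recr//= addrA [in RHS]mulrDr.
by rewrite subKn// subnSK.
Qed.

End Integral.

Theorem mainTheorem4 (R : realType) (l mu : R) (n : nat) (t : nat -> R)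
  (l_gt0 : 0 < l) (mu_gt0 : 0 < mu) (n_gt0 : (0 < n)%N)
  (t_incr : forall i k : nat, (1 <= i)%N -> (i < k)%N -> (k <= n)%N -> t i < t k)
  (t0_le_t1 : l `^ mu^-1 <= t 1%N) :
  ((forall j : nat, (1 <= j <= n)%N -> mu != j%:R) ->
     autocorrelation l mu n t = autocorrelation_formula l mu n t) /\
  ((exists2 j : nat, (1 <= j <= n)%N & mu = j%:R) ->
     autocorrelation_formula l nu n t @[nu --> mu^'] --> autocorrelation l mu n t).
Proof.
have t_gt0 k : (1 <= k <= n)%N -> 0 < t k.
  case/andP; case: k => // k _ kn.
  exact: (node_gt0 l_gt0 t_incr t0_le_t1 kn).
have mu0 : mu != 0 by rewrite gt_eqF.
rewrite (autocorrelationE l_gt0 mu_gt0 n_gt0 t_incr t0_le_t1).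
split=> [nores|[j0 j0n muj0]].
  by rewrite (autocorrelation_formulaE _ _ n_gt0 mu0 nores).
(* At a resonance [log_formula] is still continuous, so it suffices that the two formulas agree on a
   punctured neighbourhood of [mu]. *)
have cF := cvg_log_formula l_gt0 t_gt0 n_gt0 mu0.
have cF' : log_formula l n t nu @[nu --> mu^'] --> log_formula l n t mu.
  by apply: cvg_trans cF; apply: cvg_app; exact: cvg_within.
apply: cvg_trans cF'; apply: near_eq_cvg; near=> nu.
have nu_mu : nu != mu by near: nu; exact: nbhs_dnbhs_neq.
(* Since [mu] is an integer at least 1, a [nu] other than [mu] within distance 1 is nonzero and not
   an integer. *)
have nu1 : `|mu - nu| < 1.
  near: nu; apply: nbhs_dnbhs; exact: cvgr_dist_lt (@cvg_id _ (nbhs mu)) _ ltr01.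
apply/esym/autocorrelation_formulaE => //.
  apply: contraTneq nu1 => ->; rewrite subr0 muj0 normr_nat -leNgt ler1n.
  by case/andP: j0n.
move=> j jn; apply: contraNneq nu_mu => nuj.
move: nu1; rewrite nuj muj0 eqr_nat eqn_leq -(ltnS j0) -(ltnS j).
rewrite -(ltr_nat R j) -(ltr_nat R j0) -(natr1 j) -(natr1 j0).
by rewrite ltr_norml => /andP[lo hi]; apply/andP; split; lra.
Unshelve. all: by end_near. Qed.
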